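(* Let $(A,p,0,1)$ be a set $A$ with a ternary operation $p:A\times A\times A\to A$ and two constants $0,1\in A$ satisfying axioms (T1)--(T4). For $\bar a=p(1,a,0)$, $a\cdot b=p(0,a,b)$ and $a+b=p(a,b,\bar a)$, the following conditions are equivalent: (i) $(A,+,\cdot,0,1)$ is a unitary ring of characteristic $2$; (ii) $p(a,b,c)=(\bar b\cdot a)+(b\cdot c)$ for all $a,b,c\in A$; (iii) $a\cdot(b+c)=(a\cdot b)+(a\cdot c)$ for all $a,b,c\in A$.
   Context: Axioms, for all $a,b,c,b_1,b_2,b_3\in A$: (T1) $p(0,a,1)=a$; (T2) $p(a,0,b)=a=p(b,1,a)$; (T3) $p(a,b,a)=a$; (T4) $p(a,p(b_1,b_2,b_3),c)=p(p(a,b_1,c),b_2,p(a,b_3,c))$. A unitary ring (not necessarily commutative) of characteristic $2$ means a ring with zero $0$ and unit $1$ in which $b+b=0$ for all $b$. *)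

(* Defs.v *)
From mathcomp Require Import all_boot.
Set Implicit Arguments.
Unset Strict Implicit.
Unset Printing Implicit Defensive.

Section TernaryAlgebra.

Variables (A : Type) (p : A -> A -> A -> A) (zero one : A).

Record is_ternary_algebra : Prop := IsTernaryAlgebra {
  ternT1 : forall a, p zero a one = a;
  ternT2l : forall a b, p a zero b = a;
  ternT2r : forall a b, p b one a = a;
  ternT3 : forall a b, p a b a = a;
  ternT4 : forall a b1 b2 b3 c,
    p a (p b1 b2 b3) c = p (p a b1 c) b2 (p a b3 c)
}.

Definition tbar (a : A) : A := p one a zero.
Definition tmul (a b : A) : A := p zero a b.
Definition tadd (a b : A) : A := p a b (tbar a).

End TernaryAlgebra.

Section RingOperations.

Variables (A : Type) (add mul : A -> A -> A) (zero one : A).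

(* The axioms of a MathComp [pzRingType], stated for given operations on a bare
   type (no [choiceType] structure).  As in [pzRingType], [zero = one] is
   allowed, so the one-element ring is a ring. *)
Record is_unitary_ring : Prop := IsUnitaryRing {
  uringDA : associative add;
  uringDC : commutative add;
  uring0D : left_id zero add;
  uringDN : forall a, exists b, add b a = zero;
  uringMA : associative mul;
  uring1M : left_id one mul;
  uringM1 : right_id one mul;
  uringMDl : left_distributive mul add;
  uringMDr : right_distributive mul add
}.

Definition is_unitary_ring_char2 : Prop :=
  is_unitary_ring /\ forall b, add b b = zero.

End RingOperations.

(* Main.v *)
Require Import Defs.
From mathcomp Require Import all_boot.

(** In every algebra satisfying (T1)-(T4), multiplication and addition are
    monoid laws; what a ring of characteristic 2 requires on top of this is
    that every element be its own opposite (which makes a monoid a commutative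
    group) and the two distributive laws.

    The key fact is that (T4), read with middle argument [p a b c] and the
    outer pair [d], [bar d], says that translations are automorphisms of the
    outer arguments: [d + p a b c = p (d + a) b (d + c)] ([taddl_tern]).  Once
    [a + a = 0] holds, translating by [a] turns the left argument into [0], so
    [a + p a b c = b * (a + c)] and hence [p a b c = a + b * (a + c)]
    ([tern_char2]): the ternary operation is determined by the binary ones.

    - (i) implies (ii), because in a ring of characteristic 2 the right-hand
      side is [(1 + b) * a + b * c].
    - (ii) implies (iii): with equal outer arguments, (ii) reads
      [bar b * a + b * a = a] by (T3).  For [a = 1] this is
      [bar (b + b) = bar b + b = 1], so [b + b = 0]; then
      [a * (b + c) = b + p b a c = b + bar a * b + a * c = a * b + a * c].
    - (iii) implies (i): [0 = a * 0 = a * (1 + 1) = a + a], and right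
      distributivity follows from [(a + b) * d = p (a * d) b (bar a * d)] by
      expanding with [tern_char2]. *)

Set Implicit Arguments.
Unset Strict Implicit.

Section SelfInverseMonoid.

Variables (A : Type) (add : A -> A -> A) (zero : A).
Hypotheses (addA : associative add) (add0l : left_id zero add).
Hypotheses (add0r : right_id zero add) (addxx : forall a, add a a = zero).

Lemma self_inverse_addKl a b : add a (add a b) = b.
Proof. by rewrite addA addxx add0l. Qed.

(** [(a + b) + (a + b) = 0] gives [b + (a + b) = a] after translating by [a],
    and then [a + b = b + a] after translating by [b]. *)
Lemma self_inverse_addC : commutative add.
Proof.
move=> a b.
have abab : add (add a b) (add a b) = zero by exact: addxx.
have bab : add b (add a b) = a.
  by rewrite -[LHS](self_inverse_addKl a) [add a (add b _)]addA abab add0r.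
by rewrite -[LHS](self_inverse_addKl b) bab.
Qed.

End SelfInverseMonoid.

Section TernaryAlgebraTheory.

Variables (A : Type) (p : A -> A -> A -> A) (zero one : A).
Hypothesis Hp : is_ternary_algebra p zero one.

Local Notation bar := (tbar p zero one).
Local Notation mul := (tmul p zero).
Local Notation add := (tadd p zero one).

Lemma tbarK a : bar (bar a) = a.
Proof.
by rewrite /tbar (ternT4 Hp) (ternT2r Hp) (ternT2l Hp) (ternT1 Hp).
Qed.

(** Complementing the middle argument exchanges the outer ones, since [bar]
    is itself [p] with [1] and [0] exchanged. *)
Lemma tern_bar a b c : p a (bar b) c = p c b a.
Proof. by rewrite /tbar (ternT4 Hp) (ternT2r Hp) (ternT2l Hp). Qed.

Lemma bar_tern a b c : bar (p a b c) = p (bar a) b (bar c).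
Proof. exact: (ternT4 Hp). Qed.

Lemma tern_mulr a b c d : mul (p a b c) d = p (mul a d) b (mul c d).
Proof. exact: (ternT4 Hp). Qed.

Lemma tmul0r a : mul a zero = zero.
Proof. exact: (ternT3 Hp). Qed.

Lemma tmul1l : left_id one mul.
Proof. by move=> a; apply: (ternT2r Hp). Qed.

Lemma tmul1r : right_id one mul.
Proof. by move=> a; apply: (ternT1 Hp). Qed.

Lemma tmulA : associative mul.
Proof.
move=> a b c; rewrite [RHS]tern_mulr.
by rewrite (_ : mul zero c = zero) //; apply: (ternT2l Hp).
Qed.

Lemma tbar0 : bar zero = one.
Proof. exact: (ternT2l Hp). Qed.

Lemma tadd0l : left_id zero add.
Proof. by move=> a; rewrite /tadd tbar0 (ternT1 Hp). Qed.

Lemma tadd0r : right_id zero add.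
Proof. by move=> a; apply: (ternT2l Hp). Qed.

Lemma tadd1l a : add one a = bar a.
Proof. by rewrite /tadd /tbar (ternT2r Hp). Qed.

Lemma tbarD a b : bar (add a b) = add (bar a) b.
Proof. exact: bar_tern. Qed.

(** This is (T4) with outer pair [d], [bar d]: a left translation acts on the
    outer arguments of [p] and leaves the middle one fixed. *)
Lemma taddl_tern d a b c : add d (p a b c) = p (add d a) b (add d c).
Proof. exact: (ternT4 Hp). Qed.

(** Both bracketings are [p (a + b) c (bar (a + b))], because
    [a + bar b = p a (bar b) (bar a) = p (bar a) b a = bar (a + b)]. *)
Lemma taddA : associative add.
Proof.
move=> a b c; rewrite [add b c]/tadd taddl_tern.
have -> : add a (bar b) = bar (add a b).
  by rewrite tbarD /tadd tern_bar tbarK.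
by [].
Qed.

Section Characteristic2.

Hypothesis addxx : forall a, add a a = zero.

(** Translating by [a] makes the left argument of [p a b c] vanish, and [p]
    with left argument [0] is multiplication. *)
Lemma tern_shift a b c : add a (p a b c) = mul b (add a c).
Proof. by rewrite taddl_tern addxx. Qed.

Lemma tern_char2 a b c : p a b c = add a (mul b (add a c)).
Proof.
by rewrite -tern_shift (self_inverse_addKl taddA tadd0l addxx).
Qed.

End Characteristic2.

(** In a ring of characteristic 2, [bar b = 1 + b], so the right-hand side is
    [a + b * a + b * c], the expansion of [tern_char2]. *)
Lemma char2_ring_ternE :
  is_unitary_ring_char2 add mul zero one ->
  forall a b c, p a b c = add (mul (bar b) a) (mul b c).
Proof.
move=> [R addxx] a b c.
by rewrite (tern_char2 addxx) -tadd1l (uringMDl R) (uringMDr R) tmul1l taddA.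
Qed.

(** The formula applied to [p 1 a 1 = 1] gives [bar a + a = 1].  The left side
    is [bar (a + a)], so [a + a = bar 1 = 0]. *)
Lemma ternE_addxx :
  (forall a b c, p a b c = add (mul (bar b) a) (mul b c)) ->
  forall a, add a a = zero.
Proof.
move=> ternE a.
have bar_addxx : bar (add a a) = bar zero.
  by rewrite tbarD tbar0 -[RHS](ternT3 Hp _ a) ternE !tmul1r.
by rewrite -[LHS]tbarK bar_addxx tbarK.
Qed.

(** The product [a * (b + c)] is [b + p b a c] by [tern_shift]; expanding
    [p b a c] leaves [b + bar a * b], which equals [a * b] because [b] is the
    sum of [bar a * b] and [a * b]. *)
Lemma ternE_mulDr :
  (forall a b c, p a b c = add (mul (bar b) a) (mul b c)) ->
  right_distributive mul add.
Proof.
move=> ternE a b c; have addxx := ternE_addxx ternE.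
have addKl := self_inverse_addKl taddA tadd0l addxx.
have addC := self_inverse_addC taddA tadd0l tadd0r addxx.
have split_b : b = add (mul (bar a) b) (mul a b).
  by rewrite -ternE (ternT3 Hp).
rewrite -(tern_shift addxx) ternE taddA; congr (add _ _).
by rewrite {1}split_b addC addKl.
Qed.

(** Since [1 + 1 = bar 1 = 0] always holds, distributing [a] over [1 + 1]
    suffices. *)
Lemma mulDr_addxx :
  right_distributive mul add -> forall a, add a a = zero.
Proof.
move=> mulDr a.
have add11 : add one one = zero by rewrite tadd1l /tbar (ternT2r Hp).
by rewrite -{1 2}[a]tmul1r -mulDr add11 tmul0r.
Qed.

(** Right multiplication distributes over [p] in its outer arguments, so
    [(a + b) * d = p (a * d) b (bar a * d) = a * d + b * (a * d + bar a * d)],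
    and [a * d + bar a * d = d]. *)
Lemma mulDr_mulDl :
  right_distributive mul add -> left_distributive mul add.
Proof.
move=> mulDr a b d; have addxx := mulDr_addxx mulDr.
have addKl := self_inverse_addKl taddA tadd0l addxx.
have addC := self_inverse_addC taddA tadd0l tadd0r addxx.
have mul_bar : mul (bar a) d = add (mul a d) d.
  by rewrite /tmul tern_bar (tern_char2 addxx) tadd0r addC.
by rewrite {1}/tadd tern_mulr (tern_char2 addxx) mul_bar addKl.
Qed.

Lemma mulDr_char2_ring :
  right_distributive mul add -> is_unitary_ring_char2 add mul zero one.
Proof.
move=> mulDr; have addxx := mulDr_addxx mulDr.
split=> //; split=> //.
- exact: taddA.
- exact: self_inverse_addC taddA tadd0l tadd0r addxx.
- exact: tadd0l.
- by move=> a; exists a.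
- exact: tmulA.
- exact: tmul1l.
- exact: tmul1r.
- exact: mulDr_mulDl.
Qed.

End TernaryAlgebraTheory.

Theorem theorem5p2 (A : Type) (p : A -> A -> A -> A) (zero one : A)
    (Hp : is_ternary_algebra p zero one) :
  let bar := tbar p zero one in
  let mul := tmul p zero in
  let add := tadd p zero one in
  let cond_i := is_unitary_ring_char2 add mul zero one in
  let cond_ii :=
    forall a b c : A, p a b c = add (mul (bar b) a) (mul b c) in
  let cond_iii :=
    forall a b c : A, mul a (add b c) = add (mul a b) (mul a c) in
  (cond_i <-> cond_ii) /\ (cond_ii <-> cond_iii) /\ (cond_i <-> cond_iii).
Proof.
move=> bar mul add cond_i cond_ii cond_iii.
have i_ii : cond_i -> cond_ii by exact: char2_ring_ternE.
have ii_iii : cond_ii -> cond_iii by exact: ternE_mulDr.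
have iii_i : cond_iii -> cond_i by exact: mulDr_char2_ring.
by split; [|split]; split; auto.
Qed.
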